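(* Let $K$ be a field, let $m\ge 1$ and let $d_1,\ldots,d_m,k\ge 0$ be integers with $k\le\min(d_1,\ldots,d_m)$. There is a (finite) decomposition $\mathrm{Poly}_1^{(d_1-k,\ldots,d_m-k)}=\bigsqcup_i C_i$ into locally closed subvarieties, where each $C_i$ is isomorphic to a product of $\mathbb{A}^1$'s and $\mathbb{G}_m$'s, such that the surjective morphism $$\Psi:\mathrm{Poly}_1^{(d_1-k,\ldots,d_m-k)}\times\mathbb{A}^k\to R_{1,k}^{(d_1,\ldots,d_m)}\setminus R_{1,k+1}^{(d_1,\ldots,d_m)},\qquad (f_1,\ldots,f_m,g)\mapsto(f_1g,\ldots,f_mg),$$ is an isomorphism (onto its image, a locally closed subvariety of the target) when restricted to each $C_i\times\mathbb{A}^k$.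
   Context: All varieties are over the base field $K$. The affine space $\mathbb{A}^d\cong\mathrm{Sym}^d(\mathbb{A}^1)$ is identified with the space of monic polynomials of degree $d$ in one variable $z$, via $(a_1,\ldots,a_d)\leftrightarrow z^d+a_1z^{d-1}+\cdots+a_d$. $\mathrm{Poly}_1^{(e_1,\ldots,e_m)}\subset\mathbb{A}^{e_1}\times\cdots\times\mathbb{A}^{e_m}$ is the open subvariety of tuples $(f_1,\ldots,f_m)$ of monic polynomials of degrees $e_1,\ldots,e_m$ that do not all share a common (nonconstant) factor. $R_{1,\ell}^{(d_1,\ldots,d_m)}\subset\mathbb{A}^{d_1}\times\cdots\times\mathbb{A}^{d_m}$ is the closed subvariety (with reduced structure) of tuples $(h_1,\ldots,h_m)$ of monic polynomials of degrees $d_1,\ldots,d_m$ which all share a common factor of degree $\ge\ell$; it is empty when $\ell>\min_i d_i$. Locally closed subsets are given their reduced structure. *)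

(* Defs.v *)
From HB Require Import structures.
From mathcomp Require Import all_boot all_order all_algebra.
From mathcomp.multinomials Require Import mpoly.

Set Implicit Arguments.
Unset Strict Implicit.
Unset Printing Implicit Defensive.

Import GRing.Theory.
Local Open Scope ring_scope.

(* Varieties over an arbitrary (possibly finite or imperfect) field K are
   handled through their points in an algebraically closed extension
   iota : K -> Omega, topologised by the polynomials with coefficients in K.
   By the Nullstellensatz the locally closed subsets of Omega^n for this
   topology correspond to the locally closed subsets of the scheme A^n_K, hence
   to its reduced locally closed subschemes; and as regular functions on a
   reduced K-scheme of finite type are determined by their values at
   Omega-points, the K-morphisms between such subschemes are the maps on
   Omega-points given locally by quotients of polynomials over K. *)

Definition subset_of (Omega : closedFieldType) (n : nat) := 'rV[Omega]_n -> Prop.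

Section KVarieties.

Variables (K : fieldType) (Omega : closedFieldType).
Variable iota : {rmorphism K -> Omega}.

Definition evalK (n : nat) (P : {mpoly K[n]}) (x : 'rV[Omega]_n) : Omega :=
  mmap iota (fun j => x 0 j) P.

Definition zariski_closed (n : nat) (Z : subset_of Omega n) : Prop :=
  exists E : {mpoly K[n]} -> Prop,
    forall x, Z x <-> (forall P, E P -> evalK P x = 0).

Definition zariski_open (n : nat) (U : subset_of Omega n) : Prop :=
  zariski_closed (fun x => ~ U x).

Definition locally_closed (n : nat) (X : subset_of Omega n) : Prop :=
  exists U Z : subset_of Omega n,
    [/\ zariski_open U, zariski_closed Z & forall x, X x <-> U x /\ Z x].

Definition regular_function (n : nat) (X : subset_of Omega n)
    (f : 'rV[Omega]_n -> Omega) : Prop :=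
  forall x, X x ->
    exists (U : subset_of Omega n) (P Q : {mpoly K[n]}),
      [/\ zariski_open U, U x &
          forall y, X y -> U y -> evalK Q y != 0 /\ f y = evalK P y / evalK Q y].

Definition morphism (n p : nat) (X : subset_of Omega n) (Y : subset_of Omega p)
    (f : 'rV[Omega]_n -> 'rV[Omega]_p) : Prop :=
  (forall x, X x -> Y (f x)) /\
  (forall j : 'I_p, regular_function X (fun x => f x 0 j)).

Definition isomorphism (n p : nat) (X : subset_of Omega n)
    (Y : subset_of Omega p) (f : 'rV[Omega]_n -> 'rV[Omega]_p) : Prop :=
  morphism X Y f /\
  exists g : 'rV[Omega]_p -> 'rV[Omega]_n,
    [/\ morphism Y X g, forall x, X x -> g (f x) = x
      & forall y, Y y -> f (g y) = y].

Definition isomorphic (n p : nat) (X : subset_of Omega n)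
    (Y : subset_of Omega p) : Prop :=
  exists f, isomorphism X Y f.

End KVarieties.

Section PointSets.

Variable Omega : closedFieldType.

Definition affine_space (n : nat) : subset_of Omega n := fun _ => True.

(* The n-fold product of the multiplicative group, as an open subset of the
   affine space of dimension n. *)
Definition Gm_power (n : nat) : subset_of Omega n :=
  fun x => forall j, x 0 j != 0.

Definition prod_set (n p : nat) (X : subset_of Omega n)
    (Y : subset_of Omega p) : subset_of Omega (n + p) :=
  fun x => X (lsubmx x) /\ Y (rsubmx x).

Definition image_set (n p : nat) (f : 'rV[Omega]_n -> 'rV[Omega]_p)
    (X : subset_of Omega n) : subset_of Omega p :=
  fun y => exists x, X x /\ f x = y.

(* (a_1, ..., a_d) |-> z^d + a_1 z^(d-1) + ... + a_d, with a_(j+1) stored at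
   index j. *)
Definition monic_of (d : nat) (a : 'rV[Omega]_d) : {poly Omega} :=
  'X^d + \sum_(j < d) a 0 j *: 'X^(d - j.+1).

(* Inverse of monic_of on the monic polynomials of degree d. *)
Definition coords_of (d : nat) (p : {poly Omega}) : 'rV[Omega]_d :=
  \row_(j < d) p`_(d - j.+1).

(* A point of A^(e_1) x ... x A^(e_m) is a row vector of length e_1 + ... + e_m,
   split into blocks by submxrow. *)
Definition tuple_poly (m : nat) (e : 'I_m -> nat)
    (x : 'rV[Omega]_(\sum_i e i)) (i : 'I_m) : {poly Omega} :=
  monic_of (submxrow x i).

(* For l = 0 or nonzero f i this says that the f i share a factor of degree at
   least l; size is degree plus one, so that l < size g excludes g = 0. *)
Definition common_factor (m : nat) (l : nat) (f : 'I_m -> {poly Omega}) : Prop :=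
  exists g : {poly Omega}, (l < size g)%N /\ forall i, g %| f i.

Definition Poly1 (m : nat) (e : 'I_m -> nat) : subset_of Omega (\sum_i e i) :=
  fun x => ~ common_factor 1 (tuple_poly x).

Definition R1 (m : nat) (l : nat) (d : 'I_m -> nat) :
    subset_of Omega (\sum_i d i) :=
  fun x => common_factor l (tuple_poly x).

Definition R1_diff (m : nat) (k : nat) (d : 'I_m -> nat) :
    subset_of Omega (\sum_i d i) :=
  fun x => R1 k x /\ ~ R1 k.+1 x.

(* (f_1, ..., f_m, g) |-> (f_1 g, ..., f_m g). *)
Definition Psi (m : nat) (d : 'I_m -> nat) (k : nat)
    (x : 'rV[Omega]_(\sum_i (d i - k) + k)) : 'rV[Omega]_(\sum_i d i) :=
  \mxrow_i coords_of (d i) (tuple_poly (lsubmx x) i * monic_of (rsubmx x)).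

End PointSets.

Arguments affine_space {Omega} n.
Arguments Gm_power {Omega} n.
Arguments Poly1 {Omega m} e.
Arguments R1 {Omega m} l d.
Arguments R1_diff {Omega m} k d.
Arguments Psi {Omega m} d k.

(* Main.v *)
Require Import Defs.
From HB Require Import structures.
From mathcomp Require Import all_boot all_order all_algebra.
From mathcomp.multinomials Require Import mpoly.

Set Implicit Arguments.
Unset Strict Implicit.
Unset Printing Implicit Defensive.

Import GRing.Theory.
Local Open Scope ring_scope.

(** Run the Euclidean algorithm on a tuple (f_1, ..., f_m) one leading term at a
    time.  If f_i and f_j are monic with deg f_i >= deg f_j, put
    s = deg f_i - deg f_j; then r = f_i - z^s f_j has smaller degree than f_i,
    and either r = 0 or r = c r' with c a nonzero constant and r' monic.
    Replace f_i by 0 or by r' and repeat, with zero entries set aside.  A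
    tuple without common factor ends with a single nonzero entry, equal to 1.
    The pair (i, j) is a function of the degrees only, so the record of all
    steps, called a path here, depends only on the successive degrees; finitely
    many paths occur and they cut Poly_1 into strata.  On one stratum the tuple
    is rebuilt polynomially from the leading coefficients c met on the way, and
    these are arbitrary nonzero constants: the stratum is a power of G_m.  Only
    factors G_m occur, because cancelling one leading term at a time splits
    every free coefficient into the cases zero and nonzero.

    Multiplying all f_i by a monic g of degree k changes neither the steps nor
    the constants c: each nonzero remainder is multiplied by g, so its degree
    goes up by k, and the last entry is g in place of 1.  Hence the same path,
    read with degrees shifted by k, describes the image of C x A^k under Psi by
    vanishing conditions and nonvanishing leading coefficients, and it recovers
    both the constants (therefore the f_i) and g by rational formulas in the
    coefficients of the f_i g.  This is the inverse of Psi on the stratum.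

    The algebra is in [path_of_build] and [build_of_path] (a path together
    with its constants and g is the same as a tuple following the path),
    [paths_cover] and [paths_disjoint] (the partition); the geometry is in
    [follows_in_family], which shows by induction on the path that following it
    is a locally closed condition on which the constants and g are regular. *)

(** * Regular functions and locally closed sets *)

Section RegularFunctions.

Variables (K : fieldType) (Omega : closedFieldType).
Variable iota : {rmorphism K -> Omega}.

(** A single fraction for the whole domain: the constants met in the Euclidean
    algorithm are of this kind, and the form survives sums, products and
    inverses without gluing local fractions. *)
Definition globally_regular (n : nat) (X : subset_of Omega n)
    (f : 'rV[Omega]_n -> Omega) : Prop :=
  exists P Q : {mpoly K[n]}, forall x, X x ->
    evalK iota Q x != 0 /\ f x = evalK iota P x / evalK iota Q x.

Definition regular_poly (n : nat) (X : subset_of Omega n)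
    (p : 'rV[Omega]_n -> {poly Omega}) : Prop :=
  forall j, globally_regular X (fun x => (p x)`_j).

Section FixedDomain.

Variables (n : nat) (X : subset_of Omega n).
Local Notation regular := (globally_regular X).

Lemma evalK1 (x : 'rV[Omega]_n) : evalK iota 1 x = 1.
Proof. exact: rmorph1. Qed.

Lemma evalKD P Q (x : 'rV[Omega]_n) :
  evalK iota (P + Q) x = evalK iota P x + evalK iota Q x.
Proof. exact: rmorphD. Qed.

Lemma evalKM P Q (x : 'rV[Omega]_n) :
  evalK iota (P * Q) x = evalK iota P x * evalK iota Q x.
Proof. exact: rmorphM. Qed.

Lemma regular_eq f g : (forall x, X x -> f x = g x) -> regular f -> regular g.
Proof.
move=> fg [P [Q PQ]]; exists P, Q => x Xx.
by have [Q0 fE] := PQ x Xx; rewrite -fg.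
Qed.

Lemma regular_sub (Y : subset_of Omega n) f :
  (forall x, X x -> Y x) -> globally_regular Y f -> regular f.
Proof. by move=> XY [P [Q PQ]]; exists P, Q => x /XY/PQ. Qed.

Lemma regular_poly_function P : regular (evalK iota P).
Proof. by exists P, 1 => x _; rewrite evalK1 divr1 oner_neq0. Qed.

Lemma regular_const a : regular (fun=> iota a).
Proof.
apply: regular_eq (regular_poly_function a%:MP) => x _.
exact: mmapC.
Qed.

Lemma regular_coord j : regular (fun x => x 0 j).
Proof.
apply: regular_eq (regular_poly_function 'X_j) => x _.
by rewrite /evalK mmapX mmap1U.
Qed.

Lemma regular0 : regular (fun=> 0).
Proof. by apply: regular_eq (regular_const 0) => x _; rewrite rmorph0. Qed.

Lemma regularD f g : regular f -> regular g -> regular (fun x => f x + g x).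
Proof.
move=> [P [Q PQ]] [P' [Q' PQ']].
exists (P * Q' + P' * Q), (Q * Q') => x Xx.
have [Q0 ->] := PQ x Xx; have [Q'0 ->] := PQ' x Xx.
by rewrite evalKD !evalKM mulf_neq0 // addf_div.
Qed.

Lemma regularM f g : regular f -> regular g -> regular (fun x => f x * g x).
Proof.
move=> [P [Q PQ]] [P' [Q' PQ']].
exists (P * P'), (Q * Q') => x Xx.
have [Q0 ->] := PQ x Xx; have [Q'0 ->] := PQ' x Xx.
by rewrite !evalKM mulf_neq0 // mulf_div.
Qed.

Lemma regularN f : regular f -> regular (fun x => - f x).
Proof.
move=> /(regularM (regular_const (-1))); apply: regular_eq => x _.
by rewrite rmorphN1 mulN1r.
Qed.

Lemma regularV f : (forall x, X x -> f x != 0) -> regular f ->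
  regular (fun x => (f x)^-1).
Proof.
move=> f0 [P [Q PQ]]; exists Q, P => x Xx.
have [Q0 fE] := PQ x Xx; have := f0 x Xx; rewrite fE invf_div.
by move=> nz; split=> //; apply: contra_neq nz => ->; rewrite mul0r.
Qed.

Lemma regular_sum I (r : seq I) (f : I -> 'rV[Omega]_n -> Omega) :
  (forall i, regular (f i)) -> regular (fun x => \sum_(i <- r) f i x).
Proof.
move=> rf; elim: r => [|i r IH].
  by apply: regular_eq regular0 => x _; rewrite big_nil.
by apply: regular_eq (regularD (rf i) IH) => x _; rewrite big_cons.
Qed.

Lemma regular_polyD p q : regular_poly X p -> regular_poly X q ->
  regular_poly X (fun x => p x + q x).
Proof.
move=> rp rq j; apply: regular_eq (regularD (rp j) (rq j)) => x _.
by rewrite coefD.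
Qed.

Lemma regular_polyN p : regular_poly X p -> regular_poly X (fun x => - p x).
Proof.
by move=> rp j; apply: regular_eq (regularN (rp j)) => x _; rewrite coefN.
Qed.

Lemma regular_polyZ f p : regular f -> regular_poly X p ->
  regular_poly X (fun x => f x *: p x).
Proof.
by move=> rf rp j; apply: regular_eq (regularM rf (rp j)) => x _; rewrite coefZ.
Qed.

Lemma regular_polyM p q : regular_poly X p -> regular_poly X q ->
  regular_poly X (fun x => p x * q x).
Proof.
move=> rp rq j; have r (i : 'I_j.+1) := regularM (rp i) (rq (j - i)%N).
apply: regular_eq (regular_sum (index_enum 'I_j.+1) r) => x _.
by rewrite coefM.
Qed.

Lemma regular_polyXn s : regular_poly X (fun=> 'X^s).
Proof.
move=> j; apply: regular_eq (regular_const (j == s)%:R) => x _.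
by rewrite coefXn rmorph_nat.
Qed.

Lemma regular_poly_monic d (a : 'rV[Omega]_n -> 'rV[Omega]_d) :
  (forall j, regular (fun x => a x 0 j)) ->
  regular_poly X (fun x => monic_of (a x)).
Proof.
move=> ra j; apply: regular_eq; last first.
  apply: (regularD (regular_polyXn d j)).
  apply: (regular_sum (index_enum 'I_d)) => i.
  exact: regularM (ra i) (regular_polyXn (d - i.+1) j).
by move=> x _; rewrite coefD coef_sum; congr (_ + _);
  apply: eq_bigr => i _; rewrite coefZ.
Qed.

End FixedDomain.

Lemma regular_polyS n (X Y : subset_of Omega n) p :
  (forall x, X x -> Y x) -> regular_poly Y p -> regular_poly X p.
Proof. by move=> XY rp j; apply: regular_sub XY (rp j). Qed.

(** The intersection of a closed set with one principal open set.  This special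
    kind of locally closed set is stable under imposing [f = 0] or [f != 0] for
    [f] regular on it, because the denominator of [f] vanishes nowhere there;
    conditions can therefore be added one after the other. *)
Definition basic_set (n : nat) (X : subset_of Omega n) : Prop :=
  exists (E : {mpoly K[n]} -> Prop) (Q : {mpoly K[n]}), forall x,
    X x <-> (forall P, E P -> evalK iota P x = 0) /\ evalK iota Q x != 0.

Lemma basic_locally_closed n (X : subset_of Omega n) :
  basic_set X -> locally_closed iota X.
Proof.
move=> [E [Q XE]].
exists (fun x => evalK iota Q x != 0).
exists (fun x => forall P, E P -> evalK iota P x = 0).
split; [exists (eq Q) => x|by exists E|by move=> x; rewrite XE; split=> -[]].
split=> [/negP/negPn/eqP Q0 P <- // | Q0]; apply/negP/negPn/eqP; exact: Q0.
Qed.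

Lemma basic_ext n (X Y : subset_of Omega n) :
  (forall x, X x <-> Y x) -> basic_set X -> basic_set Y.
Proof. by move=> XY [E [Q XE]]; exists E, Q => x; rewrite -XY XE. Qed.

Lemma basicT n : @basic_set n (fun=> True).
Proof. by exists (fun=> False), 1 => x; rewrite evalK1 oner_neq0; split. Qed.

(** The index type is arbitrary since a closed set may be cut out by any set of
    equations; the bound on a degree below uses infinitely many. *)
Lemma basic_zeros n (X : subset_of Omega n) (I : Type)
    (f : I -> 'rV[Omega]_n -> Omega) :
    basic_set X -> (forall i, globally_regular X (f i)) ->
  basic_set (fun x => X x /\ forall i, f i x = 0).
Proof.
move=> [E [Q XE]] rf.
(* The new equations are the numerators of all fractions that represent some
   [f i] on [X]: no choice of a representation is made. *)
exists (fun P => E P \/ exists (i : I) (D : {mpoly K[n]}), forall x, X x ->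
  evalK iota D x != 0 /\ f i x = evalK iota P x / evalK iota D x), Q => x.
split=> [[Xx f0]|[P0 Q0]].
  have [P0 Q0] := (XE x).1 Xx; split=> // P [/P0 //|[i [D /(_ x Xx)[D0]]]].
  by rewrite f0 => /esym/eqP; rewrite mulf_eq0 invr_eq0 (negPf D0) orbF => /eqP.
have Xx : X x by apply/XE; split=> // P EP; apply: P0; left.
split=> // i; have [P [D PD]] := rf i; have [_ ->] := PD x Xx.
by rewrite P0 ?mul0r //; right; exists i, D.
Qed.

Lemma basic_nonzero n (X : subset_of Omega n) f :
  basic_set X -> globally_regular X f -> basic_set (fun x => X x /\ f x != 0).
Proof.
move=> [E [Q XE]] [P [D PD]]; exists E, (Q * P) => x.
rewrite evalKM mulf_eq0 negb_or; split=> [[Xx]|[E0 /andP[Q0 P0]]].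
  have [D0 ->] := PD x Xx; rewrite mulf_eq0 invr_eq0 (negPf D0) orbF => ->.
  by have [E0 ->] := (XE x).1 Xx.
have Xx : X x by apply/XE.
by have [D0 ->] := PD x Xx; rewrite mulf_neq0 ?invr_eq0.
Qed.

Lemma basic_eq n (X : subset_of Omega n) f c :
    basic_set X -> globally_regular X f ->
  basic_set (fun x => X x /\ f x = iota c).
Proof.
move=> bX rf; apply: basic_ext (basic_zeros bX
  (fun _ : unit => regularD rf (regularN (regular_const X c)))) => x.
split=> -[Xx fx]; split=> //; last by rewrite fx subrr.
by apply/eqP; rewrite -subr_eq0 fx.
Qed.

Lemma basic_size_le n (X : subset_of Omega n) p N :
    basic_set X -> regular_poly X p ->
  basic_set (fun x => X x /\ (size (p x) <= N)%N).
Proof.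
move=> bX rp; apply: basic_ext (basic_zeros bX
  (fun j : nat => rp (N + j)%N)) => x.
split=> -[Xx px]; split=> //.
  by apply/leq_sizeP => j /subnKC <-.
by move=> j; apply: (leq_sizeP _ _ px); rewrite leq_addr.
Qed.

Lemma basic_size n (X : subset_of Omega n) p N :
    basic_set X -> regular_poly X p ->
  basic_set (fun x => X x /\ size (p x) = N).
Proof.
move=> bX rp; have bN := basic_size_le N bX rp.
case: N bN => [|N] bN.
  by apply: basic_ext bN => x; rewrite leqn0; split=> -[? /eqP].
have rN :=
  regular_sub (fun x (h : X x /\ (size (p x) <= N.+1)%N) => h.1) (rp N).
apply: basic_ext (basic_nonzero bN rN) => x.
split=> [[[Xx le] nz]|[Xx sN]]; last first.
  have : lead_coef (p x) != 0 by rewrite lead_coef_eq0 -size_poly_eq0 sN.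
  by rewrite lead_coefE sN.
split=> //; apply/eqP; rewrite eqn_leq le ltnNge; apply: contra nz => sN.
by rewrite (leq_sizeP _ _ sN).
Qed.

Lemma regular_lead_coef n (X : subset_of Omega n) p N :
    regular_poly X p -> (forall x, X x -> size (p x) = N) ->
  globally_regular X (fun x => lead_coef (p x)).
Proof.
move=> rp sp; apply: regular_eq (rp N.-1) => x Xx.
by rewrite lead_coefE sp.
Qed.

Lemma basic_monic n (X : subset_of Omega n) p N :
    basic_set X -> regular_poly X p ->
  basic_set (fun x => X x /\ (p x \is monic /\ size (p x) = N)).
Proof.
move=> bX rp; have bN := basic_size N bX rp.
have rl : globally_regular (fun x => X x /\ size (p x) = N)
    (fun x => lead_coef (p x)).
  apply: (@regular_lead_coef _ _ _ N) => [|x []//].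
  by apply: regular_polyS rp => x [].
apply: basic_ext (basic_eq 1 bN rl) => x; rewrite rmorph1.
by split=> [[[Xx s] /eqP m]|[Xx [/eqP m s]]].
Qed.

Lemma regular_morphism n p (X : subset_of Omega n) (Y : subset_of Omega p) f :
    (forall x, X x -> Y (f x)) ->
    (forall j, globally_regular X (fun x => f x 0 j)) ->
  morphism iota X Y f.
Proof.
move=> XY rf; split=> // j x Xx; have [P [Q PQ]] := rf j.
exists (fun=> True), P, Q; split=> // [|y Xy _]; last exact: PQ.
exists (fun R => R = 1) => y; split=> [/(_ I)//|/(_ 1 erefl)/eqP].
by rewrite evalK1 oner_eq0.
Qed.

End RegularFunctions.

(** * Euclidean algorithm on tuples of polynomials *)

Section EuclideanPaths.

Variables (Omega : closedFieldType) (m : nat).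
Local Notation tuple := {ffun 'I_m -> {poly Omega}}.
Local Notation profile := {ffun 'I_m -> nat}.
Local Notation step := ('I_m * 'I_m * nat)%type.

Definition upd (T : Type) (f : {ffun 'I_m -> T}) (i : 'I_m) (y : T) :=
  [ffun l => if l == i then y else f l].

Lemma upd_same T (f : {ffun 'I_m -> T}) i y : upd f i y i = y.
Proof. by rewrite ffunE eqxx. Qed.

Lemma upd_neq T (f : {ffun 'I_m -> T}) i y l : l != i -> upd f i y l = f l.
Proof. by rewrite ffunE => /negPf->. Qed.

Definition remainder (i j : 'I_m) (s : nat) (h : tuple) : {poly Omega} :=
  h i - h j * 'X^s.

(** A zero remainder stays zero, as both the inverse and the leading coefficient
    of 0 are 0. *)
Definition reduce (i j : 'I_m) (s : nat) (h : tuple) : tuple :=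
  let r := remainder i j s h in upd h i ((lead_coef r)^-1 *: r).

Definition expand (i j : 'I_m) (s : nat) (c : Omega) (h : tuple) : tuple :=
  upd h i (h j * 'X^s + c *: h i).

Lemma lead_coef_normalK (p : {poly Omega}) :
  lead_coef p *: ((lead_coef p)^-1 *: p) = p.
Proof.
have [->|p0] := eqVneq p 0; first by rewrite !scaler0.
by rewrite scalerA divff ?scale1r // lead_coef_eq0.
Qed.

Lemma reduceK i j s (h : tuple) : i != j ->
  expand i j s (lead_coef (remainder i j s h)) (reduce i j s h) = h.
Proof.
move=> ij; apply/ffunP=> l; rewrite /expand /reduce.
have [->|li] := eqVneq l i; last by rewrite !upd_neq.
by rewrite !upd_same upd_neq 1?eq_sym // lead_coef_normalK addrC subrK.
Qed.

(** The entries before and after a step generate the same ideal. *)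
Lemma reduce_dvdp i j s (h : tuple) g : i != j ->
  (forall l, g %| reduce i j s h l) <-> (forall l, g %| h l).
Proof.
move=> ij; split=> gh l.
  rewrite -(reduceK s h ij) /expand.
  have [->|li] := eqVneq l i; last by rewrite upd_neq.
  rewrite upd_same dvdp_add ?dvdp_mulr // -mul_polyC dvdp_mull //.
rewrite /reduce; have [->|li] := eqVneq l i; last by rewrite upd_neq.
by rewrite upd_same -mul_polyC dvdp_mull // dvdp_sub // dvdp_mulr.
Qed.

Lemma monic_size1 (p : {poly Omega}) : p \is monic -> size p = 1%N -> p = 1.
Proof.
move=> /monicP + sp; have /size1_polyC-> : (size p <= 1)%N by rewrite sp.
by rewrite lead_coefC => ->.
Qed.

(** Sizes, in the sense of degree plus one with 0 for the zero polynomial, after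
    multiplication by a polynomial of degree [k]. *)
Definition shifted (k t : nat) : nat := if t == 0%N then 0%N else (t + k)%N.

(** Each entry is zero or monic, of prescribed size; the condition on leading
    coefficients says this without a case distinction. *)
Definition has_shape (delta : profile) (h : tuple) : Prop :=
  forall l, size (h l) = delta l /\ lead_coef (h l) = (delta l != 0%N)%:R.

Section Path.

Variable a : 'I_m.

(** A path is an index [a] and a list of steps (i, j, s), read from the initial
    tuple on; [a] is the index of the entry that survives.  The sizes at each
    stage are not recorded: they are determined backwards from the final tuple,
    whose only nonzero entry is 1. *)
Fixpoint degrees (st : seq step) : profile :=
  if st is (i, j, s) :: st' then
    let delta := degrees st' in upd delta i (s + delta j)%N
  else [ffun l => (l == a : nat)].

Fixpoint admissible (st : seq step) : bool :=
  if st is (i, j, s) :: st' then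
    let delta := degrees st' in
    [&& i != j, 0 < delta j, delta i < s + delta j & admissible st']%N
  else true.

(** With [k = 0] these are the tuples reduced along the path to the single entry
    1, and in general the multiples of those by a monic polynomial of degree
    [k]: see [path_of_build] and [build_of_path]. *)
Fixpoint follows (k : nat) (st : seq step) (h : tuple) : Prop :=
  if st is (i, j, s) :: st' then
    size (remainder i j s h) = shifted k (degrees st' i) /\
    follows k st' (reduce i j s h)
  else (h a \is monic /\ size (h a) = k.+1) /\ forall l, l != a -> h l = 0.

Fixpoint nparams (st : seq step) : nat :=
  if st is (i, _, _) :: st' then
    ((degrees st' i != 0%N) + nparams st')%N
  else 0%N.

Fixpoint params (st : seq step) (h : tuple) : seq Omega :=
  if st is (i, j, s) :: st' then
    let v := params st' (reduce i j s h) in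
    if degrees st' i == 0%N then v else lead_coef (remainder i j s h) :: v
  else [::].

Fixpoint final (st : seq step) (h : tuple) : {poly Omega} :=
  if st is (i, j, s) :: st' then final st' (reduce i j s h) else h a.

(** A step that ends with remainder zero consumes no constant. *)
Definition pop (t : nat) (v : seq Omega) : seq Omega :=
  if t == 0%N then v else behead v.

(** The inverse of the algorithm.  When a step has remainder zero, [head 0 v]
    multiplies a zero entry, so its value does not matter. *)
Fixpoint build (st : seq step) (v : seq Omega) : tuple :=
  if st is (i, j, s) :: st' then
    expand i j s (head 0 v) (build st' (pop (degrees st' i) v))
  else [ffun l => (l == a)%:R].

Definition torus_point (b : nat) (v : seq Omega) : bool :=
  (size v == b) && (0 \notin v).

Lemma torus_point_pop i j s st v : torus_point (nparams ((i, j, s) :: st)) v ->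
  torus_point (nparams st) (pop (degrees st i) v).
Proof.
rewrite /torus_point /pop /=; have [|] := eqVneq (degrees st i) 0%N => //= _.
by case: v => [|c v] //=; rewrite add1n eqSS inE negb_or; case/and3P=> -> _ ->.
Qed.

Lemma has_shape_expand i j s c (delta : profile) h :
    i != j -> (0 < delta j)%N -> (delta i < s + delta j)%N ->
    has_shape delta h ->
  has_shape (upd delta i (s + delta j)%N) (expand i j s c h).
Proof.
move=> ij dj di hs l; rewrite /expand.
have [->|li] := eqVneq l i; last by rewrite !upd_neq.
have [sj lj] := hs j; have [si _] := hs i.
have hj0 : h j != 0 by rewrite -size_poly_eq0 sj -lt0n.
have szj : size (h j * 'X^s) = (s + delta j)%N by rewrite size_mulXn // sj.
have lt : (size (c *: h i)%R < size (h j * 'X^s)%R)%N.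
  by rewrite szj (leq_ltn_trans (size_scale_leq _ _)) // si.
rewrite !upd_same size_polyDl // lead_coefDl //.
rewrite (lead_coef_Mmonic _ (monicXn _ s)) szj lj.
by rewrite addn_eq0 -!lt0n dj negb_and -!lt0n dj orbT.
Qed.

Lemma build_shape st v : admissible st -> has_shape (degrees st) (build st v).
Proof.
elim: st v => [|[[i j] s] st IH] v /=.
  by move=> _ l; rewrite !ffunE; case: (l == a);
    rewrite ?size_poly1 ?size_poly0 ?lead_coef1 ?lead_coef0.
by case/and4P=> ij dj di /IH bs; apply: has_shape_expand.
Qed.

Definition scale_tuple (h : tuple) (g : {poly Omega}) : tuple :=
  [ffun l => h l * g].

Lemma remainder_expand i j s c h g : i != j ->
  remainder i j s (scale_tuple (expand i j s c h) g) = c *: (h i * g).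
Proof.
move=> ij; rewrite /remainder /expand !ffunE eqxx eq_sym (negPf ij).
by rewrite mulrDl mulrAC addrC addKr scalerAl.
Qed.

(** Multiplication by [g] commutes with every step: the remainder of the product
    is [g] times the remainder, with the same leading coefficient as [g] is
    monic.  So the path can be read off the product, constants included. *)
Lemma path_of_build k st v g : admissible st ->
    torus_point (nparams st) v -> g \is monic -> size g = k.+1 ->
  let h := scale_tuple (build st v) g in
  [/\ follows k st h, params st h = v & final st h = g].
Proof.
move=> + + mg sg; elim: st v => [|[[i j] s] st IH] v.
  move=> _ /andP[/nilP-> _] /=; rewrite !ffunE eqxx mul1r; split=> //.
  by split=> // l /negPf la; rewrite !ffunE la mul0r.
move=> adm tv; have /= /and4P[ij dj di ad] := adm.
have := IH _ ad (torus_point_pop tv).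
set b := build st _ => -[fo pa fi] /=; rewrite -/b.
set h := scale_tuple _ _.
have rem : remainder i j s h = head 0 v *: (b i * g) by apply: remainder_expand.
have [si li] := build_shape (pop (degrees st i) v) ad i.
rewrite -/b in si li.
have red : reduce i j s h = scale_tuple b g.
  apply/ffunP=> l; rewrite /reduce rem /h /expand.
  have [->|ne] := eqVneq l i; last by rewrite upd_neq // !ffunE (negPf ne).
  rewrite upd_same ffunE lead_coefZ scalerA lead_coefM li (monicP mg) mulr1.
  have [d0|d0] := eqVneq (degrees st i) 0%N.
    have /eqP-> : b i == 0 by rewrite -size_poly_eq0 si d0.
    by rewrite mul0r scaler0.
  rewrite mulr1 mulVf ?scale1r //.
  case/andP: tv => /= /eqP; rewrite d0; case: (v) => //= c v' _.
  by rewrite inE negb_or eq_sym => /andP[].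
rewrite red pa fi rem; have [d0|d0] := eqVneq (degrees st i) 0%N.
  have /eqP-> : b i == 0 by rewrite -size_poly_eq0 si d0.
  by rewrite mul0r scaler0 size_poly0 /pop d0.
rewrite d0 in li.
case/andP: tv => /=; rewrite d0 /pop (negPf d0); case: (v) => //= c v' _.
rewrite inE negb_or eq_sym => /andP[c0 _].
rewrite lead_coefZ lead_coefM li (monicP mg) !mulr1; split=> //; split=> //.
rewrite size_scale // size_Mmonic ?sg ?si ?addnS //=; last first.
  by rewrite -size_poly_eq0 si.
by rewrite /shifted (negPf d0).
Qed.

(** Conversely each step is undone by [reduceK], so that a tuple following the
    path is the tuple built from its constants times its last entry. *)
Lemma build_of_path k st h : admissible st -> follows k st h ->
  [/\ torus_point (nparams st) (params st h),
      final st h \is monic /\ size (final st h) = k.+1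
    & scale_tuple (build st (params st h)) (final st h) = h].
Proof.
elim: st h => [|[[i j] s] st IH] h /=.
  move=> _ [ha h0]; split=> //; apply/ffunP=> l; rewrite !ffunE.
  by have [->|/h0->] := eqVneq l a; rewrite ?mul1r ?mul0r.
case/and4P=> ij _ _ ad [sr fo].
have [tp fi hE] := IH _ ad fo; split=> //.
  have [d0|d0] := eqVneq (degrees st i) 0%N; first by rewrite add0n.
  have r0 : lead_coef (remainder i j s h) != 0.
    by rewrite lead_coef_eq0 -size_poly_eq0 sr /shifted (negPf d0) addn_eq0
      (negPf d0).
  case/andP: tp => /eqP sv v0; rewrite /torus_point /= sv add1n eqxx /=.
  by rewrite inE negb_or eq_sym r0.
rewrite -[RHS](reduceK s h ij).
set g := final _ _ in hE *; set w := params _ _ in hE *.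
set r := remainder _ _ _ _ in sr *.
have -> : pop (degrees st i)
    (if degrees st i == 0%N then w else lead_coef r :: w) = w.
  by rewrite /pop; case: eqP.
set b := build _ _ in hE *; set c := head _ _.
have bE l : b l * g = reduce i j s h l by rewrite -hE ffunE.
apply/ffunP=> l; rewrite ffunE /expand.
have [->|li] := eqVneq l i; last by rewrite 2?upd_neq // bE.
rewrite 2!upd_same mulrDl mulrAC -scalerAl !bE; congr (_ + _).
rewrite {}/c; have [d0|d0] := eqVneq (degrees st i) 0%N; last by [].
have /eqP r0 : r == 0 by rewrite -size_poly_eq0 sr /shifted d0.
by rewrite /reduce -/r upd_same r0 !scaler0.
Qed.

Lemma follows_coprime st h : admissible st -> follows 0 st h ->
  ~ common_factor 1 h.
Proof.
elim: st h => [|[[i j] s] st IH] h /=.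
  move=> _ [[ma sa] _] [g [sg gh]].
  have := gh a; rewrite (_ : h a = 1); last exact: monic_size1 ma sa.
  by rewrite dvdp1 => /eqP sg1; rewrite sg1 in sg.
case/and4P=> ij _ _ ad [_ fo] [g [sg gh]]; apply: (IH _ ad fo).
by exists g; split=> // l; apply: (reduce_dvdp s h g ij).2.
Qed.

End Path.

Definition reducible_pair (delta : profile) (ij : 'I_m * 'I_m) : bool :=
  [&& ij.1 != ij.2, 0 < delta ij.2 & delta ij.2 <= delta ij.1]%N.

(** The paths of all tuples of shape [delta] without common factor.  The pair
    (i, j) is chosen from [delta] alone, whence the strata are disjoint; when
    there is no such pair at most one entry is nonzero, and coprimality forces
    it to be 1.  The number [n] bounds the recursion depth: the sum of the
    sizes decreases at each step. *)
Fixpoint paths (n : nat) (delta : profile) : seq ('I_m * seq step) :=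
  if n is n'.+1 then
    if [pick ij | reducible_pair delta ij] is Some (i, j) then
      [seq (p.1, (i, j, (delta i - delta j)%N) :: p.2)
         | t <- iota 0 (delta i), p <- paths n' (upd delta i t)]
    else if [pick a | delta a == 1%N] is Some a then [:: (a, [::])] else [::]
  else [::].

Lemma paths_admissible n delta p : p \in paths n delta ->
  admissible p.1 p.2 /\ degrees p.1 p.2 = delta.
Proof.
elim: n delta p => [|n IH] delta p //=.
case: pickP => [[i j] /and3P[/= ij dj dij]|nopair].
  case/allpairsPdep=> t [q [+ /IH[ad dE] ->]]; rewrite mem_iota add0n /= => ti.
  have ji : j != i by rewrite eq_sym.
  rewrite dE upd_same !upd_neq // subnK // ij dj ti ad; split=> //.
  apply/ffunP=> l; have [->|li] := eqVneq l i; first by rewrite upd_same.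
  by rewrite !upd_neq.
case: pickP => // a /eqP da; rewrite inE => /eqP->; split=> //=.
apply/ffunP=> l; rewrite ffunE; have [->|la] := eqVneq l a; first by rewrite da.
have := nopair (l, a); rewrite /reducible_pair /= la da /=.
by case: (delta l).
Qed.

Lemma size_remainder i j s h (delta : profile) : has_shape delta h ->
    (0 < delta j)%N -> delta i = (s + delta j)%N ->
  (size (remainder i j s h) < delta i)%N.
Proof.
move=> hs dj di; have [si li] := hs i; have [sj lj] := hs j.
have hj0 : h j != 0 by rewrite -size_poly_eq0 sj -lt0n.
have szj : size (h j * 'X^s) = delta i by rewrite size_mulXn // sj di.
have d0 : (0 < delta i)%N by rewrite di addn_gt0 dj orbT.
rewrite -(ltn_predK d0) ltnS; apply/leq_sizeP => n; rewrite coefB leq_eqVlt.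
case/orP=> [/eqP<-|]; last first.
  by rewrite (ltn_predK d0) => dn; rewrite !nth_default ?subrr ?si ?szj.
rewrite -{1}si -{1}szj -!lead_coefE (lead_coef_Mmonic _ (monicXn _ s)).
rewrite li lj -!lt0n dj d0.
exact: subrr.
Qed.

Lemma has_shape_reduce i j s h delta : has_shape delta h ->
  has_shape (upd delta i (size (remainder i j s h))) (reduce i j s h).
Proof.
move=> hs l; rewrite /reduce.
have [->|li] := eqVneq l i; last by rewrite !upd_neq.
rewrite !upd_same; set r := remainder _ _ _ _.
have [->|r0] := eqVneq r 0; first by rewrite scaler0 size_poly0 lead_coef0.
have l0 : lead_coef r != 0 by rewrite lead_coef_eq0.
by rewrite size_scale ?invr_eq0 // lead_coefZ mulVf // size_poly_eq0 r0.
Qed.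

Lemma sum_upd_lt (delta : profile) i t : (t < delta i)%N ->
  (\sum_l upd delta i t l < \sum_l delta l)%N.
Proof.
move=> ti; rewrite (bigD1 i) //= [ltnRHS](bigD1 i) //= upd_same.
rewrite (eq_bigr delta) ?ltn_add2r // => l li; exact: upd_neq.
Qed.

Lemma paths_cover n (delta : profile) h :
    (\sum_l delta l < n)%N -> has_shape delta h -> ~ common_factor 1 h ->
  exists p, p \in paths n delta /\ follows p.1 0 p.2 h.
Proof.
elim: n delta h => [|n IH] delta h //= lt hs cop.
case: pickP => [[i j] /and3P[/= ij dj dij]|nopair].
  set s := (delta i - delta j)%N.
  have ti : (size (remainder i j s h) < delta i)%N.
    by apply: size_remainder => //; rewrite subnK.
  have [||q [qin fo]] := IH _ _ _ (has_shape_reduce i j s hs).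
  - by rewrite (leq_trans (sum_upd_lt ti)).
  - move=> [g [sg gh]]; apply: cop; exists g; split=> //.
    exact: (reduce_dvdp s h g ij).1.
  have [_ dE] := paths_admissible qin.
  exists (q.1, (i, j, s) :: q.2); split.
    apply/allpairsPdep; exists (size (remainder i j s h)), q.
    by rewrite mem_iota.
  by rewrite /= dE upd_same /shifted addn0; split=> //; case: (size _).
have [a ha0] : exists a, h a != 0.
  apply/existsP; apply: contraT; rewrite negb_exists => /forallP h0.
  (* the zero tuple has every polynomial as a common factor *)
  case: cop; exists 'X; rewrite size_polyX; split=> // l.
  by have := h0 l; rewrite negbK => /eqP->; rewrite dvdp0.
have da : (0 < delta a)%N by rewrite -(hs a).1 lt0n size_poly_eq0.
have others l : l != a -> h l = 0.
  move=> la; apply/eqP; rewrite -size_poly_eq0 (hs l).1 -leqn0 leqNgt.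
  apply/negP=> dl; case/orP: (leq_total (delta a) (delta l)) => le.
    by have := nopair (l, a); rewrite /reducible_pair /= la da le.
  by have := nopair (a, l); rewrite /reducible_pair /= eq_sym la dl le.
have da1 : delta a = 1%N.
  apply/eqP; rewrite eqn_leq da andbT leqNgt; apply/negP=> d2; apply: cop.
  exists (h a); rewrite (hs a).1; split=> // l.
  by have [->|/others->] := eqVneq l a; rewrite ?dvdpp ?dvdp0.
case: pickP => [b /eqP db|/(_ a)]; last by rewrite da1.
have <- : a = b.
  apply/eqP; rewrite eq_sym; apply: contraT => /others hb0.
  by have [] := hs b; rewrite hb0 size_poly0 db.
exists (a, [::]); rewrite inE; split=> //=; have [sa la] := hs a.
by split=> //; rewrite monicE la sa da1.
Qed.

(** Two paths starting at the same [delta] begin with the same pair, and the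
    size of the remainder decides in which sublist the rest of the path lies. *)
Lemma paths_disjoint n delta p q h :
    p \in paths n delta -> q \in paths n delta ->
  follows p.1 0 p.2 h -> follows q.1 0 q.2 h -> p = q.
Proof.
elim: n delta p q h => [|n IH] delta p q h //=.
case: pickP => [[i j] _|_]; last first.
  by case: pickP => // a _; rewrite !inE => /eqP-> /eqP->.
case/allpairsPdep=> t [p' [_ p'in ->]] /allpairsPdep[t' [q' [_ q'in ->]]] /=.
have [_ dp] := paths_admissible p'in; have [_ dq] := paths_admissible q'in.
rewrite dp dq !upd_same => -[sp fp] [sq fq].
have tt' : t = t'.
  by move: sq; rewrite sp /shifted !addn0; case: (t); case: (t').
by rewrite tt' in p'in; rewrite (IH _ _ _ _ p'in q'in fp fq).
Qed.

End EuclideanPaths.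

(** * Paths in algebraic families *)

Section PathsInFamilies.

Variables (K : fieldType) (Omega : closedFieldType).
Variable iota : {rmorphism K -> Omega}.
Variables (m n : nat) (a : 'I_m).
Implicit Type X : subset_of Omega n.

(** Stated for a family of tuples over an arbitrary base, so that the induction
    can restrict the base to the locus where the first remainder has the
    prescribed size.  There its leading coefficient is regular and invertible,
    or the remainder is zero, and the reduced family is again regular. *)
Lemma follows_in_family k st X
    (h : 'rV[Omega]_n -> {ffun 'I_m -> {poly Omega}}) :
    basic_set iota X -> (forall l, regular_poly iota X (fun x => h x l)) ->
  let Y x := X x /\ follows a k st (h x) in
  [/\ basic_set iota Y,
      forall j, globally_regular iota Y (fun x => (params a st (h x))`_j)
    & regular_poly iota Y (fun x => final a st (h x))].
Proof.
elim: st X h => [|[[i j] s] st IH] X h bX rh /=.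
  split=> [|j|]; last by apply: regular_polyS (rh a) => x [].
    have bZ := basic_zeros (basic_monic k.+1 bX (rh a)) (fun
      z : {l | l != a} * nat => regular_sub
        (fun x (Yx : X x /\ (h x a \is monic /\ size (h x a) = k.+1)) => Yx.1)
        (rh (val z.1) z.2)).
    apply: basic_ext bZ => x; split=> [[[Xx ha] h0]|[Xx [ha h0]]].
      by do 2!split=> //; move=> l la; apply/polyP=> c;
        rewrite coef0 (h0 (Sub l la, c)).
    by split=> // -[[l la] c] /=; rewrite h0 ?coef0.
  by apply: regular_eq (regular0 _ _) => x _; rewrite nth_nil.
set t := degrees a st i.
have rr : regular_poly iota X (fun x => remainder i j s (h x)).
  apply: regular_polyD (rh i) (regular_polyN _).
  exact: regular_polyM (rh j) (regular_polyXn _ _ s).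
pose X1 x := X x /\ size (remainder i j s (h x)) = shifted k t.
have X1X x : X1 x -> X x by case.
have bX1 : basic_set iota X1 by apply: basic_size.
have rl : globally_regular iota X1 (fun x => lead_coef (remainder i j s (h x))).
  apply: (regular_lead_coef (N := shifted k t) (regular_polyS X1X rr)).
  by move=> x [].
have rli : globally_regular iota X1
    (fun x => (lead_coef (remainder i j s (h x)))^-1).
  have [t0|t0] := eqVneq t 0%N.
    apply: regular_eq (regular0 _ _) => x [_].
    rewrite t0 => /eqP; rewrite size_poly_eq0 => /eqP->.
    by rewrite lead_coef0 invr0.
  apply: regularV => // x [_ sr].
  by rewrite lead_coef_eq0 -size_poly_eq0 sr /shifted (negPf t0) addn_eq0
    (negPf t0).
have [l|bY rp rf] := IH X1 (fun x => reduce i j s (h x)) bX1.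
  rewrite /reduce; have [->|li] := eqVneq l i.
    move=> c.
    apply: regular_eq (regular_polyZ rli (regular_polyS X1X rr) c) => x _.
    by rewrite upd_same.
  move=> c; apply: regular_eq (regular_polyS X1X (rh l) c) => x _.
  by rewrite upd_neq.
have assoc x : (X x /\ (size (remainder i j s (h x)) = shifted k t /\
    follows a k st (reduce i j s (h x)))) <->
  (X1 x /\ follows a k st (reduce i j s (h x))) by rewrite /X1; tauto.
split; last by apply: regular_polyS rf => x /assoc.
  by apply: basic_ext bY => x; rewrite assoc.
move=> c; have [t0|t0] := eqVneq t 0%N.
  by apply: regular_sub (rp c) => x /assoc.
case: c => [|c]; last by apply: regular_sub (rp c) => x /assoc.
by apply: regular_sub rl => x /assoc[].
Qed.

Lemma build_in_family st X (v : 'rV[Omega]_n -> seq Omega) l :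
    (forall j, globally_regular iota X (fun x => (v x)`_j)) ->
  regular_poly iota X (fun x => build a st (v x) l).
Proof.
elim: st v l => [|[[i j] s] st IH] v l rv /=.
  move=> c; apply: regular_eq (regular_const iota X ((l == a) && (c == 0))%:R).
  move=> x _; rewrite rmorph_nat ffunE.
  by case: (l == a); rewrite ?coef1 ?coef0.
have rpop c : globally_regular iota X
    (fun x => (pop (degrees a st i) (v x))`_c).
  rewrite /pop; case: eqP => _ //.
  by apply: regular_eq (rv c.+1) => x _; rewrite nth_behead.
rewrite /expand; have [->|li] := eqVneq l i.
  move=> c; apply: regular_eq; last first.
    apply: (regular_polyD _ _ c); last first.
      exact: regular_polyZ (rv 0%N) (IH _ i rpop).
    exact: regular_polyM (IH _ j rpop) (regular_polyXn _ _ s).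
  by move=> x _; rewrite upd_same nth0.
by move=> c; apply: regular_eq (IH _ l rpop c) => x _; rewrite upd_neq.
Qed.

End PathsInFamilies.

(** * Coordinates on tuples of monic polynomials *)

Section Coordinates.

Variable Omega : closedFieldType.

Lemma size_monic_tail d (u : 'rV[Omega]_d) :
  (size (\sum_(j < d) u 0 j *: 'X^(d - j.+1))%R < size ('X^d : {poly Omega}))%N.
Proof.
rewrite size_polyXn ltnS; apply: leq_trans (size_sum _ _ _) _.
apply/bigmax_leqP => j _; apply: leq_trans (size_scale_leq _ _) _.
by rewrite size_polyXn subnSK // leq_subr.
Qed.

Lemma size_monic_of d (u : 'rV[Omega]_d) : size (monic_of u) = d.+1.
Proof. by rewrite /monic_of size_polyDl ?size_monic_tail ?size_polyXn. Qed.

Lemma monic_of_monic d (u : 'rV[Omega]_d) : monic_of u \is monic.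
Proof. by rewrite monicE lead_coefDl ?size_monic_tail // lead_coefXn. Qed.

Lemma monic_ofK d : cancel (@monic_of Omega d) (@coords_of Omega d).
Proof.
move=> u; apply/rowP => j; rewrite mxE coefD coefXn.
rewrite ltn_eqF ?add0r; last by rewrite -subSn // subSS leq_subr.
rewrite coef_sum (bigD1 j) //= coefZ coefXn eqxx mulr1 big1 ?addr0 // => l lj.
rewrite coefZ coefXn; case: eqP => [/eqP|]; last by rewrite mulr0.
rewrite eqn_sub2lE // eqSS => /eqP/val_inj jl.
by rewrite jl eqxx in lj.
Qed.

Lemma coords_ofK d (p : {poly Omega}) : p \is monic -> size p = d.+1 ->
  monic_of (coords_of d p) = p.
Proof.
move=> mp sp; apply/polyP => c.
have [cd|dc|->] := ltngtP c d.
- have lt : (d - c.+1 < d)%N by rewrite subnSK // leq_subr.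
  have := congr1 (fun w : 'rV_d => w 0 (Ordinal lt))
    (monic_ofK (coords_of d p)).
  by rewrite !mxE /= subnSK // subKn // ltnW.
- by rewrite !nth_default ?size_monic_of ?sp.
have := monic_of_monic (coords_of d p); rewrite monicE lead_coefE size_monic_of.
by move=> /eqP->; move: mp; rewrite monicE lead_coefE sp => /eqP.
Qed.

Section Tuples.

Variables (m : nat) (e : 'I_m -> nat).
Local Notation tuple := {ffun 'I_m -> {poly Omega}}.

Definition tuple_at (x : 'rV[Omega]_(\sum_i e i)) : tuple :=
  [ffun i => tuple_poly x i].

Definition point_of (h : tuple) : 'rV[Omega]_(\sum_i e i) :=
  \mxrow_i coords_of (e i) (h i).

Lemma tuple_at_monic x i : tuple_at x i \is monic.
Proof. by rewrite ffunE monic_of_monic. Qed.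

Lemma size_tuple_at x i : size (tuple_at x i) = (e i).+1.
Proof. by rewrite ffunE size_monic_of. Qed.

Lemma tuple_atK : cancel tuple_at point_of.
Proof.
move=> x; rewrite /point_of -[RHS]submxrowK; apply: eq_mxrow => i.
by rewrite ffunE monic_ofK.
Qed.

Lemma point_ofK (h : tuple) :
    (forall i, h i \is monic /\ size (h i) = (e i).+1) ->
  tuple_at (point_of h) = h.
Proof.
move=> hh; apply/ffunP=> i; have [mi si] := hh i.
by rewrite ffunE /tuple_poly mxrowK coords_ofK.
Qed.

Lemma common_factor_tuple_at l x :
  common_factor l (tuple_at x) <-> common_factor l (tuple_poly x).
Proof.
by split=> -[g [sg gx]]; exists g; split=> // i; have := gx i; rewrite ffunE.
Qed.

End Tuples.

Lemma Psi_tuple m (d : 'I_m -> nat) k (hk : forall i, (k <= d i)%N) x :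
  tuple_at (Psi d k x) =
  scale_tuple (tuple_at (e := fun i => (d i - k)%N) (lsubmx x))
              (monic_of (rsubmx x)).
Proof.
rewrite -[RHS](@point_ofK _ d); last first.
  move=> i; rewrite !ffunE monicMr ?monic_of_monic //.
  rewrite size_Mmonic ?monic_of_monic //.
    by rewrite !size_monic_of addnS addSn subnK.
  by rewrite monic_neq0 ?monic_of_monic.
by congr tuple_at; apply: eq_mxrow => i; rewrite !ffunE.
Qed.

End Coordinates.

(** * Common factors of exact degree *)

Section CommonFactors.

Variables (Omega : closedFieldType) (m : nat).
Implicit Types (f h : {ffun 'I_m -> {poly Omega}}) (g : {poly Omega}).

(** If [G] divides all the [f i * g], then [G] divided by its gcd with [g]
    divides all the [f i] by the lemma of Gauss, and it is nonconstant as soon as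
    [deg G > deg g]. *)
Lemma scale_tuple_no_common_factor f g k : ~ common_factor 1 f ->
  size g = k.+1 -> ~ common_factor k.+1 (scale_tuple f g).
Proof.
move=> cop sg [G [sG Gfg]]; apply: cop.
have g0 : g != 0 by rewrite -size_poly_eq0 sg.
have G0 : G != 0 by rewrite -size_poly_gt0 (leq_trans _ sG).
set D := gcdp G g; have D0 : D != 0 by rewrite gcdp_eq0 negb_and G0.
have GE : G %/ D * D = G by rewrite divpK // dvdp_gcdl.
exists (G %/ D); split=> [|i].
  have q0 : G %/ D != 0 by apply: contraNneq G0 => q0; rewrite -GE q0 mul0r.
  have sD : (size D <= k.+1)%N by rewrite -sg dvdp_leq // dvdp_gcdr.
  rewrite ltnNge; apply/negP=> sq; move: sG; rewrite -GE size_mul // ltnNge.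
  case/negP; rewrite -subn1 leq_subLR; exact: leq_add.
have cop : coprimep (G %/ D) (g %/ D) by rewrite coprimep_div_gcd // G0.
rewrite -(Gauss_dvdpl _ cop) -(dvdp_mul2r _ _ D0) GE -mulrA.
by rewrite divpK ?dvdp_gcdr //; have := Gfg i; rewrite ffunE.
Qed.

(** A common factor whose degree is the largest possible leaves coprime
    cofactors. *)
Lemma exact_common_factor h k : (0 < m)%N -> (forall i, h i \is monic) ->
    common_factor k h -> ~ common_factor k.+1 h ->
  exists f g, [/\ scale_tuple f g = h, g \is monic, size g = k.+1,
    forall i, f i \is monic & ~ common_factor 1 f].
Proof.
move=> m0 mh [G [sG Gh]] nGh.
have G0 : G != 0 by rewrite -size_poly_gt0 (leq_trans _ sG).
have l0 : lead_coef G != 0 by rewrite lead_coef_eq0.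
set g := (lead_coef G)^-1 *: G.
have mg : g \is monic by rewrite monicE lead_coefZ mulVf.
have g0 : g != 0 by rewrite monic_neq0.
have gh i : g %| h i by rewrite dvdpZl ?invr_eq0.
have sg : size g = k.+1.
  rewrite size_scale ?invr_eq0 //; apply/eqP; rewrite eqn_leq sG andbT leqNgt.
  by apply/negP=> sG'; apply: nGh; exists G.
have hE i : h i %/ g * g = h i by rewrite divpK.
exists [ffun i => h i %/ g], g; split=> //.
- by apply/ffunP=> i; rewrite !ffunE.
- by move=> i; rewrite ffunE -(monicMr _ mg) hE.
move=> [E [sE Ef]]; apply: nGh; exists (E * g); split=> [|i].
  have E0 : E != 0 by rewrite -size_poly_gt0 (leq_trans _ sE).
  by rewrite size_mul // sg addnS; exact: (leq_add sE (leqnn k)).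
by rewrite -hE dvdp_mul2r //; have := Ef i; rewrite ffunE.
Qed.

End CommonFactors.

(** * The strata and the morphism Psi *)

Section Strata.

Variables (K : fieldType) (Omega : closedFieldType).
Variable iota : {rmorphism K -> Omega}.

Lemma regular_tuple_at m (e : 'I_m -> nat) n (X : subset_of Omega n)
    (x : 'rV[Omega]_n -> 'rV[Omega]_(\sum_i e i)) :
    (forall j, globally_regular iota X (fun t => x t 0 j)) ->
  forall i, regular_poly iota X (fun t => tuple_at (x t) i).
Proof.
move=> rx i c; apply: regular_eq; last first.
  apply: (@regular_poly_monic _ _ iota _ X (e i) (fun t => submxrow (x t) i)) c.
  move=> j; apply: regular_eq (rx (tagnat.Rank i j)) => t _.
  by rewrite mxE.
by move=> t _; rewrite ffunE.
Qed.

Lemma regular_point_of m (e : 'I_m -> nat) n (X : subset_of Omega n)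
    (h : 'rV[Omega]_n -> {ffun 'I_m -> {poly Omega}}) :
    (forall i, regular_poly iota X (fun t => h t i)) ->
  forall j, globally_regular iota X (fun t => point_of e (h t) 0 j).
Proof.
move=> rh j; apply: regular_eq (rh (tagnat.sig1 j)
  (e (tagnat.sig1 j) - (tagnat.sig2 j).+1)%N) => t _.
by rewrite !mxE.
Qed.

Lemma regular_coords_of d n (X : subset_of Omega n) p :
    regular_poly iota X p ->
  forall j, globally_regular iota X (fun t => coords_of d (p t) 0 j).
Proof.
by move=> rp j; apply: regular_eq (rp (d - j.+1)%N) => t _; rewrite mxE.
Qed.

Lemma regular_row_mx p q n (X : subset_of Omega n)
    (u : 'rV[Omega]_n -> 'rV[Omega]_p) (v : 'rV[Omega]_n -> 'rV[Omega]_q) :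
    (forall j, globally_regular iota X (fun t => u t 0 j)) ->
    (forall j, globally_regular iota X (fun t => v t 0 j)) ->
  forall j, globally_regular iota X (fun t => row_mx (u t) (v t) 0 j).
Proof.
move=> ru rv j; rewrite -(splitK j); case: (split j) => l /=.
  by apply: regular_eq (ru l) => t _; rewrite row_mxEl.
by apply: regular_eq (rv l) => t _; rewrite row_mxEr.
Qed.

Lemma regular_lsubmx p q (X : subset_of Omega (p + q)) j :
  globally_regular iota X (fun t => lsubmx t 0 j).
Proof.
by apply: regular_eq (regular_coord _ _ (lshift q j)) => t _; rewrite mxE.
Qed.

Lemma regular_rsubmx p q (X : subset_of Omega (p + q)) j :
  globally_regular iota X (fun t => rsubmx t 0 j).
Proof.
by apply: regular_eq (regular_coord _ _ (rshift p j)) => t _; rewrite mxE.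
Qed.

Definition path_locus m (e : 'I_m -> nat) (a : 'I_m) (k : nat)
    (st : seq ('I_m * 'I_m * nat)) : subset_of Omega (\sum_i e i) :=
  fun x => follows a k st (tuple_at x).

Lemma path_locus_regular m (e : 'I_m -> nat) a k st :
  let Y := path_locus (e := e) a k st in
  [/\ basic_set iota Y,
      forall j, globally_regular iota Y (fun y => (params a st (tuple_at y))`_j)
    & regular_poly iota Y (fun y => final a st (tuple_at y))].
Proof.
have [bY rp rf] := follows_in_family a k st (basicT iota _)
  (regular_tuple_at (regular_coord iota (fun=> True) (n := \sum_i e i))).
split; first by apply: basic_ext bY => y; split=> [[]|].
  by move=> j; apply: regular_sub (rp j).
by apply: regular_polyS rf.
Qed.

Section Psi.

Variables (m k : nat) (d : 'I_m -> nat).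
Hypothesis hk : forall i, (k <= d i)%N.
Let e i := (d i - k)%N.

Lemma Psi_point (x : 'rV[Omega]_(\sum_i e i + k)) : Psi d k x =
  point_of d (scale_tuple (tuple_at (e := e) (lsubmx x)) (monic_of (rsubmx x))).
Proof. by rewrite -(Psi_tuple hk) tuple_atK. Qed.

Lemma regular_Psi (X : subset_of Omega (\sum_i e i + k)) j :
  globally_regular iota X (fun x => Psi d k x 0 j).
Proof.
apply: (@regular_eq _ _ iota _ X (fun x => point_of d
  (scale_tuple (tuple_at (e := e) (lsubmx x)) (monic_of (rsubmx x))) 0 j)).
  by move=> x _; rewrite Psi_point.
apply: regular_point_of => i c; apply: regular_eq; last first.
  apply: (regular_polyM (regular_tuple_at _ i) _ c).
  - exact: regular_lsubmx.
  - apply: regular_poly_monic => l; exact: regular_rsubmx.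
by move=> x _; rewrite ffunE.
Qed.

Lemma Psi_morphism :
  morphism iota (prod_set (Poly1 e) (affine_space k)) (R1_diff k d) (Psi d k).
Proof.
apply: regular_morphism (regular_Psi _) => x [cop _].
rewrite /R1_diff /R1 -!common_factor_tuple_at (Psi_tuple hk).
split.
  exists (monic_of (rsubmx x)); rewrite size_monic_of; split=> // i.
  by rewrite ffunE dvdp_mull.
apply: scale_tuple_no_common_factor (size_monic_of _).
by rewrite common_factor_tuple_at.
Qed.

Lemma Psi_surjective : (0 < m)%N ->
  forall y : 'rV[Omega]_(\sum_i d i), R1_diff k d y ->
  exists x, prod_set (Poly1 e) (affine_space k) x /\ Psi d k x = y.
Proof.
move=> m0 y; rewrite /R1_diff /R1 -!common_factor_tuple_at => -[cf ncf].
have [f [g [fg mg sg mf cop]]] :=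
  exact_common_factor m0 (@tuple_at_monic _ _ _ y) cf ncf.
have fE : tuple_at (point_of e f) = f.
  apply: point_ofK => i; split=> //.
  have := size_tuple_at y i; rewrite -fg ffunE size_Mmonic ?monic_neq0 // sg.
  by rewrite addnS /= /e => sf; rewrite -subSn // -sf addnK.
exists (row_mx (point_of e f) (coords_of k g)); split.
  rewrite /prod_set row_mxKl; split=> //.
  by rewrite /Poly1 -common_factor_tuple_at fE.
by rewrite Psi_point row_mxKl row_mxKr fE coords_ofK // fg tuple_atK.
Qed.

Section Stratum.

Variables (a : 'I_m) (st : seq ('I_m * 'I_m * nat)).
Hypothesis ad : admissible a st.
Hypothesis dst : degrees a st = [ffun i => (e i).+1].

Local Notation stratum := (path_locus (e := e) a 0 st).
Local Notation image_stratum := (path_locus (e := d) a k st).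
Local Notation b := (nparams a st).

Lemma tuple_at_build (v : seq Omega) :
  tuple_at (point_of e (build a st v)) = build a st v.
Proof.
apply: point_ofK => i; have [si li] := build_shape v ad i.
by rewrite monicE li si dst ffunE.
Qed.

Lemma scale_tuple1 (h : {ffun 'I_m -> {poly Omega}}) : scale_tuple h 1 = h.
Proof. by apply/ffunP=> i; rewrite ffunE mulr1. Qed.

Lemma stratum_build (v : seq Omega) : torus_point b v ->
  stratum (point_of e (build a st v)) /\
  params a st (tuple_at (point_of e (build a st v))) = v.
Proof.
move=> tv; rewrite /path_locus tuple_at_build.
have [] := path_of_build (k := 0) ad tv (monic1 _) (size_poly1 _).
by rewrite scale_tuple1.
Qed.

Lemma stratumE x : stratum x ->
  torus_point b (params a st (tuple_at x)) /\
  build a st (params a st (tuple_at x)) = tuple_at x.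
Proof.
move=> /(build_of_path ad)[tv [mf sf]].
by rewrite (monic_size1 mf sf) scale_tuple1.
Qed.

(** On a stratum the last entry is 1, so its tuples are the tuples built from
    their constants, and [path_of_build] applies to their multiples. *)
Lemma params_Psi x : prod_set stratum (affine_space k) x ->
  [/\ image_stratum (Psi d k x),
      params a st (tuple_at (Psi d k x)) = params a st (tuple_at (lsubmx x))
    & final a st (tuple_at (Psi d k x)) = monic_of (rsubmx x)].
Proof.
move=> [/stratumE[tv bE] _]; rewrite /path_locus (Psi_tuple hk) -{1 2 4}bE.
apply: path_of_build => //; [exact: monic_of_monic | exact: size_monic_of].
Qed.

(** The constants found along the path of the product rebuild the cofactors, and
    the last entry is the common factor. *)
Definition Psi_inverse (y : 'rV[Omega]_(\sum_i d i)) :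
    'rV[Omega]_(\sum_i e i + k) :=
  row_mx (point_of e (build a st (params a st (tuple_at y))))
         (coords_of k (final a st (tuple_at y))).

Lemma Psi_inverseK x : prod_set stratum (affine_space k) x ->
  Psi_inverse (Psi d k x) = x.
Proof.
move=> Cx; have [_ pE fE] := params_Psi Cx; have [_ bE] := stratumE Cx.1.
by rewrite /Psi_inverse pE fE bE tuple_atK monic_ofK hsubmxK.
Qed.

Lemma Psi_Psi_inverse y : image_stratum y ->
  prod_set stratum (affine_space k) (Psi_inverse y) /\
  Psi d k (Psi_inverse y) = y.
Proof.
move=> /(build_of_path ad)[tv [mf sf] hE].
rewrite /prod_set Psi_point /Psi_inverse row_mxKl row_mxKr.
split; first by split=> //; apply: (stratum_build tv).1.
by rewrite tuple_at_build coords_ofK // hE tuple_atK.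
Qed.

Lemma image_Psi_stratum y :
  image_set (Psi d k) (prod_set stratum (affine_space k)) y <-> image_stratum y.
Proof.
split=> [[x [/params_Psi[Dx _ _] <-]]//|/Psi_Psi_inverse Dy].
by exists (Psi_inverse y).
Qed.

Lemma stratum_locally_closed : locally_closed iota stratum.
Proof. by apply: basic_locally_closed; case: (path_locus_regular e a 0 st). Qed.

Lemma image_stratum_locally_closed : locally_closed iota
  (image_set (Psi d k) (prod_set stratum (affine_space k))).
Proof.
apply: basic_locally_closed.
apply: (basic_ext (fun y => iff_sym (image_Psi_stratum y))).
by case: (path_locus_regular d a k st).
Qed.

Lemma Psi_isomorphism :
  isomorphism iota (prod_set stratum (affine_space k))
    (image_set (Psi d k) (prod_set stratum (affine_space k))) (Psi d k).
Proof.
split; first by apply: regular_morphism (regular_Psi _) => x Cx; exists x.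
exists Psi_inverse; split.
- have [_ rp rf] := path_locus_regular d a k st.
  apply: regular_morphism => [y /image_Psi_stratum/Psi_Psi_inverse[]//|j].
  apply: (@regular_sub _ _ iota _ _ image_stratum).
    by move=> y /image_Psi_stratum.
  apply: regular_row_mx j; first apply: regular_point_of => i.
    exact: build_in_family.
  exact: regular_coords_of.
- exact: Psi_inverseK.
- by move=> y /image_Psi_stratum/Psi_Psi_inverse[].
Qed.

(** The width [0 + b] is that of the product of a zero-dimensional affine space
    and a torus. *)
Definition torus_seq (y : 'rV[Omega]_(0 + b)) : seq Omega :=
  [seq y 0 j | j <- enum 'I_(0 + b)].

Lemma nth_torus_seq y (j : 'I_(0 + b)) : (torus_seq y)`_j = y 0 j.
Proof. by rewrite (nth_map j) ?size_enum_ord // nth_ord_enum. Qed.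

Lemma torus_seqP y : prod_set (affine_space 0) (Gm_power b) y <->
  torus_point b (torus_seq y).
Proof.
rewrite /torus_point size_map size_enum_ord eqxx /=.
split=> [[_ y0]|y0].
  apply/mapP=> -[j _ /eqP]; rewrite eq_sym; apply/negP.
  by have := y0 j; rewrite mxE (_ : rshift 0 j = j) //; apply: val_inj.
split=> // j; rewrite mxE; apply: contra y0 => /eqP yj.
by apply/mapP; exists (rshift 0 j); rewrite ?mem_enum.
Qed.

(** The constants [params] and the reconstruction [build] are inverse to each
    other, and both are regular. *)
Lemma stratum_isomorphic_torus :
  isomorphic iota stratum (prod_set (affine_space 0) (Gm_power b)).
Proof.
pose f (x : 'rV[Omega]_(\sum_i e i)) : 'rV[Omega]_(0 + b) :=
  \row_j (params a st (tuple_at x))`_j.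
have fE x : stratum x -> torus_seq (f x) = params a st (tuple_at x).
  move=> /stratumE[/andP[/eqP sp _] _].
  apply: (@eq_from_nth _ 0); first by rewrite size_map size_enum_ord sp.
  move=> j; rewrite size_map size_enum_ord => jb.
  by rewrite (nth_torus_seq _ (Ordinal jb)) mxE.
exists f; split.
  apply: regular_morphism => [x Cx|j].
    by apply/torus_seqP; rewrite fE //; case: (stratumE Cx).
  have [_ rp _] := path_locus_regular e a 0 st.
  by apply: regular_eq (rp j) => x _; rewrite mxE.
exists (fun y => point_of e (build a st (torus_seq y))); split.
- apply: regular_morphism => [y /torus_seqP/stratum_build[]//|].
  apply: regular_point_of => i; apply: build_in_family => j.
  have [jb|bj] := ltnP j b.
    apply: regular_eq (regular_coord _ _ (Ordinal jb)) => y _.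
    by rewrite -(nth_torus_seq y (Ordinal jb)).
  apply: regular_eq (regular0 _ _) => y _.
  by rewrite nth_default // size_map size_enum_ord.
- by move=> x Cx; rewrite fE //; have [_ ->] := stratumE Cx; rewrite tuple_atK.
- move=> y /torus_seqP/stratum_build[_ pE]; apply/rowP=> j.
  by rewrite mxE pE nth_torus_seq.
Qed.

End Stratum.

End Psi.

End Strata.

Theorem proposition3p1 (K : fieldType) (Omega : closedFieldType)
    (iota : {rmorphism K -> Omega}) (m : nat) (d : 'I_m -> nat) (k : nat)
    (hm : (0 < m)%N) (hk : forall i, (k <= d i)%N) :
  let e := fun i : 'I_m => (d i - k)%N in
  [/\ morphism iota (prod_set (Poly1 e) (affine_space k)) (R1_diff k d)
        (Psi d k),
      forall y : 'rV[Omega]_(\sum_i d i), R1_diff k d y ->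
        exists x, prod_set (Poly1 e) (affine_space k) x /\ Psi d k x = y
    & exists (r : nat) (C : 'I_r -> subset_of Omega (\sum_i e i)),
        [/\ forall x, Poly1 e x <-> exists i, C i x,
            forall i j x, C i x -> C j x -> i = j
          & forall i,
              [/\ locally_closed iota (C i),
                  exists a b : nat,
                    isomorphic iota (C i)
                      (prod_set (affine_space a) (Gm_power b)),
                  locally_closed iota
                    (image_set (Psi d k) (prod_set (C i) (affine_space k)))
                & isomorphism iota (prod_set (C i) (affine_space k))
                    (image_set (Psi d k) (prod_set (C i) (affine_space k)))
                    (Psi d k)]]].
Proof.
move=> e; split; [exact: Psi_morphism | exact: Psi_surjective |].
pose delta : {ffun 'I_m -> nat} := [ffun i => (e i).+1].
(* Without repetitions, so that distinct indices have distinct paths. *)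
pose L := undup (paths (\sum_l delta l).+1 delta).
pose path i := tnth (in_tuple L) i.
have pathin i : path i \in paths (\sum_l delta l).+1 delta.
  by rewrite -mem_undup mem_tnth.
exists (size L), (fun i => path_locus (e := e) (path i).1 0 (path i).2); split.
- move=> x; rewrite /Poly1 -common_factor_tuple_at; split=> [cop|[i fo]].
    have hs : has_shape delta (tuple_at x).
      move=> i; rewrite size_tuple_at ffunE; split=> //.
      by apply/eqP; rewrite -monicE tuple_at_monic.
    have [p [pin fo]] := paths_cover (ltnSn _) hs cop.
    have /tnthP[i pE] : p \in in_tuple L by rewrite mem_undup.
    by exists i; rewrite /path_locus /path -pE.
  by have [ad _] := paths_admissible (pathin i); apply: follows_coprime ad fo.
- move=> i j x fi fj; have := paths_disjoint (pathin i) (pathin j) fi fj.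
  by apply: tuple_uniqP; rewrite undup_uniq.
move=> i; have [ad dE] := paths_admissible (pathin i); split.
- exact: stratum_locally_closed.
- exists 0%N, (nparams (path i).1 (path i).2); exact: stratum_isomorphic_torus.
- exact: image_stratum_locally_closed.
- exact: Psi_isomorphism.
Qed.
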